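(* Let $X$ be an infinite rigid compact metric space and let $f\in\mathcal{S}(X)$. Then $(X,f)$ does not have shadowing.
   Context: For a compact metric space $(X,d)$, $\mathcal{S}(X)$ is the set of continuous surjections $f:X\to X$; $\omega$ denotes the non-negative integers. For $\delta>0$, a $\delta$-pseudo-orbit for a continuous $f:X\to X$ is a sequence $\langle x_i\rangle_{i\in\omega}$ in $X$ with $d(f(x_i),x_{i+1})<\delta$ for all $i\in\omega$. $(X,f)$ has shadowing if for every $\epsilon>0$ there is $\delta>0$ such that for every $\delta$-pseudo-orbit $\langle x_i\rangle$ for $f$ there is $z\in X$ with $d(x_i,f^i(z))<\epsilon$ for all $i\in\omega$. $(X,f)$ is uniformly rigid if for every $\epsilon>0$ there is $n>0$ such that $d(f^n(x),x)<\epsilon$ for all $x\in X$. The compact metric space $X$ is rigid if $(X,f)$ is uniformly rigid for every $f\in\mathcal{S}(X)$. *)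

(* Defs.v *)
From HB Require Import structures.
From mathcomp Require Import all_boot all_order all_algebra.
From mathcomp Require Import all_classical all_reals all_analysis.

Set Implicit Arguments.
Unset Strict Implicit.
Unset Printing Implicit Defensive.

Import Order.TTheory GRing.Theory Num.Theory.

Local Open Scope classical_set_scope.
Local Open Scope ring_scope.

Definition continuous_surjections (X : topologicalType) : set (X -> X) :=
  [set f | continuous f /\ set_surj [set: X] [set: X] f].
Arguments continuous_surjections X _ : clear implicits.

Definition pseudo_orbit (R : realType) (X : metricType R) (f : X -> X)
    (delta : R) (x : nat -> X) : Prop :=
  forall i, mdist (f (x i)) (x i.+1) < delta.

Definition has_shadowing (R : realType) (X : metricType R) (f : X -> X) : Prop :=
  forall eps : R, 0 < eps ->
    exists2 delta : R, 0 < delta &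
      forall x : nat -> X, pseudo_orbit f delta x ->
        exists z : X, forall i, mdist (x i) (iter i f z) < eps.

Definition uniformly_rigid (R : realType) (X : metricType R) (f : X -> X) : Prop :=
  forall eps : R, 0 < eps ->
    exists2 n : nat, (0 < n)%N & forall x : X, mdist (iter n f x) x < eps.

Definition rigid_space (R : realType) (X : metricType R) : Prop :=
  forall f : X -> X, continuous_surjections X f -> uniformly_rigid f.

(* Main.v *)
Require Import Defs.
From HB Require Import structures.
From mathcomp Require Import all_boot all_order all_algebra.
From mathcomp Require Import all_classical all_reals all_analysis.
From mathcomp Require Import lra.

Set Implicit Arguments.
Unset Strict Implicit.
Unset Printing Implicit Defensive.

Import Order.TTheory GRing.Theory Num.Theory.

Local Open Scope classical_set_scope.
Local Open Scope ring_scope.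

(** Suppose that [f] has shadowing; rigidity of [X] makes [f] uniformly rigid.
These two properties together force [X] to be zero-dimensional. Indeed, choose
[n] such that [f^n] is very close to the identity. A chain of points with small
steps becomes a pseudo-orbit of [f] once [n] consecutive times are spent on
following the true orbit of each of its points. Two chains that end in the same
constant tail give pseudo-orbits that eventually agree, so that their shadowing
orbits are eventually close; as some late iterate of [f] is nearly the
identity, the shadowing points themselves are close, and so are the initial
points of the two chains. Comparing an arbitrary chain with the constant one at
its endpoint shows that small-step chains cannot travel far
([shadowing_chains_small]), and the classes of points joined by such chains are
small clopen sets ([rigid_shadowing_zero_dimensional]).

On the other hand an infinite zero-dimensional compact metric space always has
a continuous surjection onto itself that is not injective
([zero_dimensional_noninj]). If the isolated points accumulate at a point that
is not isolated, shift a sequence of isolated points converging to it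
([isolated_accumulation_noninj]). Otherwise some proper nonempty clopen set has
no isolated points; it maps onto the Cantor space, hence onto the whole of [X],
while the rest of [X] can be left fixed ([perfect_clopen_noninj]). Since a
uniformly rigid map is injective ([uniformly_rigid_inj]), such a surjection
contradicts the rigidity of [X]. *)

(** * Uniformly rigid maps *)

(** An iterate close to the identity separates distinct points, whereas all
positive iterates identify two points with the same image. *)
Lemma uniformly_rigid_inj (R : realType) (X : metricType R) (f : X -> X) :
  uniformly_rigid f -> injective f.
Proof.
move=> rf x y fxy; apply/eqP/negP => /negP xy.
have d0 : 0 < mdist x y by rewrite mdist_gt0.
have [|n n0 nf] := rf (mdist x y / 2); first by rewrite divr_gt0.
have fnxy : iter n f x = iter n f y.
  by case: n n0 {nf} => // n _; rewrite !iterSr fxy.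
have := metric_triangle x (iter n f x) y.
have := nf x; have := nf y; rewrite (metric_sym x (iter n f x)) fnxy; lra.
Qed.

(** Late return times come from iterating an early one: if [f^n] moves points by
at most [c], then [f^(n k)] moves them by at most [k c]. *)
Lemma uniformly_rigid_late (R : realType) (X : metricType R) (f : X -> X) :
  uniformly_rigid f -> forall (e : R) (T : nat), 0 < e ->
  exists2 m, (T <= m)%N & forall x, mdist (iter m f x) x < e.
Proof.
move=> rf e T e0.
pose c := e / 2 / T.+1%:R.
have c0 : 0 < c by rewrite !divr_gt0.
have [n n0 nf] := rf c c0.
exists (n * T.+1)%N; first by rewrite (leq_trans (leqnSn T))// leq_pmull.
move=> x.
have le_kc k : mdist (iter (n * k) f x) x <= k%:R * c.
  elim: k => [|k IH]; first by rewrite muln0 /= mdistxx mul0r.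
  rewrite mulnS iterD (le_trans (metric_triangle _ (iter (n * k) f x) _))//.
  by rewrite -natr1 mulrDl mul1r addrC lerD// ltW.
apply: le_lt_trans (le_kc T.+1) _.
by rewrite /c mulrC divfK ?pnatr_eq0//; lra.
Qed.

(** * Chains of small steps under shadowing *)

(** The point [w k] is followed along its orbit during the times
[n k, ..., n k + n - 1], after which the sequence jumps to [w k.+1]. *)
Definition dwell (X : Type) (f : X -> X) (n : nat) (w : nat -> X) (i : nat) :=
  iter (i %% n) f (w (i %/ n)%N).

Lemma dwell_pseudo_orbit (R : realType) (X : metricType R) (f : X -> X)
    (n : nat) (w : nat -> X) (a b : R) :
  (0 < n)%N -> 0 < a -> 0 < b ->
  (forall x, mdist (iter n f x) x < a) ->
  (forall i, mdist (w i) (w i.+1) < b) ->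
  pseudo_orbit f (a + b) (dwell f n w).
Proof.
move=> n0 a0 b0 nf ww i; rewrite /dwell modnS divnS//.
case: ifPn => [ni|_]; last by rewrite add0n -iterS mdistxx addr_gt0.
(* The jump to the next point happens when i is n - 1 modulo n, so the
   application of f completes an n-th iterate. *)
have -> : f (iter (i %% n) f (w (i %/ n)%N)) = iter n f (w (i %/ n)%N).
  rewrite -iterS; congr (iter _ f _); apply/eqP; rewrite eqn_leq ltn_mod n0 /=.
  apply: dvdn_leq => //; move: ni.
  by rewrite {1}(divn_eq i n) -addnS dvdn_addr// dvdn_mull.
by rewrite add1n /= (le_lt_trans (metric_triangle _ (w (i %/ n)%N) _))// ltrD.
Qed.

(** The pseudo-orbits dwelling along [w], stopped at time [N], and along the
constant sequence [w N] coincide from time [n N] on. At a late return time [m]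
their shadowing points [y] and [z] are thus both back near their initial
positions and near the common value [q] of the pseudo-orbits at time [m], which
links [w 0] to [w N] through the six estimates [w 0 ~ y ~ f^m y ~ q ~ f^m z ~ z
~ w N]. *)
Lemma shadowing_chains_small (R : realType) (X : metricType R) (f : X -> X) :
  uniformly_rigid f -> has_shadowing f -> forall e : R, 0 < e ->
  exists2 d : R, 0 < d & forall (w : nat -> X) (N : nat),
    (forall i, mdist (w i) (w i.+1) < d) -> mdist (w 0%N) (w N) < e.
Proof.
move=> rf sf e e0; have e6 : 0 < e / 6 by rewrite divr_gt0.
have [d d0 shadow] := sf _ e6.
have d2 : 0 < d / 2 by rewrite divr_gt0.
have [n n0 nf] := rf _ d2.
exists (d / 2) => // w N ww.
pose u i := w (minn i N); pose v (i : nat) := w N.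
have shadowed t : (forall i, mdist (t i) (t i.+1) < d / 2) ->
    exists z, forall i, mdist (dwell f n t i) (iter i f z) < e / 6.
  move=> tt; apply: shadow; have := dwell_pseudo_orbit n0 d2 d2 nf tt.
  by rewrite -splitr.
have [i|y yu] := shadowed u.
  rewrite /u; have [iN|Ni] := ltnP i N; first by rewrite (minn_idPl iN).
  by rewrite (minn_idPr (leqW Ni)) mdistxx.
have [i|z zv] := shadowed v; first by rewrite /v mdistxx.
have [m mT mf] := uniformly_rigid_late rf (n * N) e6.
have uvm : dwell f n u m = dwell f n v m.
  by rewrite /dwell /u (minn_idPr _)// leq_divRL// mulnC.
have := yu 0%N; have := zv 0%N; have := yu m; have := zv m.
rewrite uvm /dwell mod0n div0n /= /u min0n /v.
have := mf y; have := mf z; set q := iter _ f (w N).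
have := metric_triangle (w 0%N) y (w N).
have := metric_triangle y (iter m f y) (w N).
have := metric_triangle (iter m f y) q (w N).
have := metric_triangle q (iter m f z) (w N).
have := metric_triangle (iter m f z) z (w N).
rewrite (metric_sym y (iter m f y)) (metric_sym (iter m f y) q).
rewrite (metric_sym z (w N)); lra.
Qed.

(** Points joined to [x] by chains of steps smaller than [d] form a clopen set
for every [d]: adding one step shows that both this set and its complement
contain the [d]-ball around each of their points. If [d] is small, no chain
joins [x] to [y]. *)
Lemma rigid_shadowing_zero_dimensional (R : realType) (X : metricType R)
    (f : X -> X) :
  uniformly_rigid f -> has_shadowing f -> zero_dimensional X.
Proof.
move=> rf sf x y xy.
have [|d d0 small] := shadowing_chains_small rf sf (e := mdist x y).
  by rewrite mdist_gt0.
pose U := [set z | exists (w : nat -> X) (N : nat),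
  [/\ forall i, mdist (w i) (w i.+1) < d, w 0%N = z & w N = x]].
have U_step z z' : mdist z z' < d -> U z' -> U z.
  move=> zz' [w [N [ww w0 wN]]].
  exists (fun i => if i is j.+1 then w j else z), N.+1; split => //.
  by case=> //=; rewrite w0.
have nbhs_near (z : X) : nbhs z [set z' | mdist z z' < d].
  by rewrite -ballEmdist; exact: nbhsx_ballx.
exists U; split.
- split; [|rewrite -[U]setCK; apply: open_closedC]; rewrite openE => z Uz.
    rewrite /interior; apply: filterS (nbhs_near z) => z' zz'.
    by apply: U_step Uz; rewrite metric_sym.
  rewrite /interior; apply: filterS (nbhs_near z) => z' zz' Uz'.
  exact/Uz/(U_step _ _ zz').
- by exists (fun=> x), 0%N; split => // i; rewrite mdistxx.
- move=> [w [N [ww w0 wN]]]; have := small w N ww.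
  by rewrite w0 wN metric_sym ltxx.
Qed.

(** * Non-injective surjections of zero-dimensional spaces *)

(** Each nonempty clopen part of [B] has two points, which a clopen set
separates; splitting again and again gives a binary tree of nonempty clopen
cells rooted at [B]. The map [phi] records on which side of each successive cut
a point lies. Every branch of the tree is realised, because by compactness a
decreasing sequence of nonempty closed cells has a common point. *)
Lemma perfect_clopen_onto_cantor (X : topologicalType) (B : set X) :
  compact [set: X] -> zero_dimensional X -> clopen B -> B !=set0 ->
  (forall x, B x -> ~ open [set x]) ->
  exists2 phi : X -> cantor_space, continuous phi & phi @` B = setT.
Proof.
move=> cptX zdX clB B0 pB.
have splitP V : exists S, clopen S /\ (clopen V -> V !=set0 -> V `<=` B ->
    V `&` S !=set0 /\ V `&` ~` S !=set0).
  have [[clV [x Vx] VB]|nV] :=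
    pselect [/\ clopen V, V !=set0 & V `<=` B]; last first.
    by exists set0; split; [exact: clopen0|move=> *; exfalso; exact: nV].
  have [y Vy xy] : exists2 y, V y & x != y.
    apply: contrapT => nxy; apply: (pB x (VB _ Vx)).
    suff <- : V = [set x] by case: clV.
    apply/seteqP; split => [y Vy|_ ->//]; apply: contrapT => yx.
    by apply: nxy; exists y => //; apply/eqP => /esym.
  have [S [clS Sx Sy]] := zdX _ _ xy.
  by exists S; split => // _ _ _; split; [exists x|exists y].
(* The set cutting V is clopen for every V, even when V is not a part of B that
   has to be split: this makes phi continuous on the whole of X. *)
have [split_ /all_and2 [split_clopen split_ok]] := choice splitP.
pose half V (b : bool) := V `&` (if b then split_ V else ~` split_ V).
have half_clopen V b : clopen V -> clopen (half V b).
  move=> clV; apply: clopenI => //; case: b => //; exact: clopenC.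
(* cell w n is reached by following the branch w, nbr x n by following x. *)
pose cell := fix cell (w : nat -> bool) n :=
  if n is m.+1 then half (cell w m) (w m) else B.
pose nbr := fix nbr (x : X) n :=
  if n is m.+1 then half (nbr x m) `[< split_ (nbr x m) x >] else B.
pose phi (x : X) : cantor_space := fun n => `[< split_ (nbr x n) x >].
have cell_ok w n : [/\ clopen (cell w n), cell w n !=set0 & cell w n `<=` B].
  elim: n => [|n [clC C0 CB]]; first by split.
  split; [exact: half_clopen| |by move=> x [/CB]].
  have [] := split_ok _ clC C0 CB.
  by rewrite /= /half; case: (w n).
have cell_decr w m n : (m <= n)%N -> cell w n `<=` cell w m.
  elim: n => [|n IH]; first by rewrite leqn0 => /eqP ->.
  by rewrite leq_eqVlt => /predU1P[->//|/IH mn] x [/mn].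
have phi_cell w x : (forall n, cell w n x) -> phi x = w.
  move=> wx; suff nbrE n : nbr x n = cell w n.
    apply/funext => n; rewrite /phi nbrE; have [_] := wx n.+1.
    by case: (w n) => h; [apply/asboolP|apply/asboolPn].
  elim: n => //= n ->; congr half; have [_] := wx n.+1.
  by case: (w n) => h; [apply/asboolP|apply/asboolPn].
have near_split V x : \forall y \near x, `[< split_ V y >] = `[< split_ V x >].
  have [Sx|Sx] := pselect (split_ V x).
    have : nbhs x (split_ V) by apply: open_nbhs_nbhs; case: (split_clopen V).
    by apply: filterS => y Sy; rewrite !asboolT.
  have : nbhs x (~` split_ V).
    apply: open_nbhs_nbhs; split => //.
    by case: (clopenC set0 (split_clopen V)).
  by apply: filterS => y Sy; rewrite !asboolF.
have near_nbr n x : \forall y \near x, nbr y n = nbr x n.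
  elim: n => [|n IH]; first exact: nearW.
  near=> y; rewrite /=.
  have -> : nbr y n = nbr x n by near: y.
  by congr half; near: y; exact: near_split.
exists phi.
  move=> x; apply/cvg_sup => n U [V] [[W] oW <-] Wx WU.
  apply: (filterS WU); rewrite nbhs_simpl /=.
  have := near_split (nbr x n) x; apply: filterS2 (near_nbr n x) => y ny sy.
  by rewrite /= /proj /phi ny sy.
apply/seteqP; split => // w _.
have cell_filter : ProperFilter (filter_from [set: nat] (cell w)).
  apply: filter_from_proper; last by move=> n _; case: (cell_ok w n).
  apply: filter_from_filter; first by exists 0%N.
  move=> m n _ _; exists (maxn m n) => // x wx.
  by split; apply: cell_decr wx; [exact: leq_maxl|exact: leq_maxr].
have [//|x [_ clx]] := cptX _ cell_filter; first exact: filterT.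
have wx n : cell w n x.
  have [[_ closedC] _ _] := cell_ok w n; apply: closedC => V xV.
  by apply: clx => //; exists n.
exists x; first exact: (wx 0%N).
exact: phi_cell.
Unshelve. all: by end_near. Qed.

(** This is the Alexandroff-Hausdorff theorem [cantor_surj], which asks for a
pointed space; [x0] supplies the point. *)
Lemma cantor_onto_compact_metric (R : realType) (X : metricType R) (x0 : X) :
  compact [set: X] ->
  exists2 g : cantor_space -> X,
    continuous g & set_surj [set: cantor_space] [set: X] g.
Proof.
move=> cptX; pose pointed := isPointed.Build X x0.
pose PX : pseudoPMetricType R := HB.pack (X : Type) pointed (Metric.class X).
have [g cg] := @cantor_surj R PX cptX (@metric_hausdorff _ X).
by exists g => //; exact: surj.
Qed.

(** Mapping [B] onto the whole of [X] and fixing its complement gives a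
continuous map since [B] is clopen; it hits [x0] both at [x0] and somewhere in
[B]. *)
Lemma perfect_clopen_noninj (R : realType) (X : metricType R) (B : set X)
    (x0 : X) :
  compact [set: X] -> zero_dimensional X -> clopen B -> B !=set0 ->
  (forall x, B x -> ~ open [set x]) -> ~ B x0 ->
  exists2 h, continuous_surjections X h & ~ injective h.
Proof.
move=> cptX zdX clB B0 pB Bx0.
have [phi cphi phiB] := perfect_clopen_onto_cantor cptX zdX clB B0 pB.
have [g cg gsurj] := cantor_onto_compact_metric x0 cptX.
pose h x := if pselect (B x) then g (phi x) else x.
have hB x : B x -> h x = g (phi x) by rewrite /h; case: pselect.
have hC x : ~ B x -> h x = x by rewrite /h; case: pselect.
have Bh y : exists2 x, B x & h x = y.
  have [c _ <-] := gsurj y I; have : [set: cantor_space] c by [].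
  by rewrite -phiB => -[x Bx <-]; exists x => //; rewrite hB.
exists h; last first.
  move=> hinj; have [b Bb hb] := Bh x0.
  by apply: (Bx0); have <- : b = x0 by apply: hinj; rewrite hb hC.
split; last by move=> y _; have [x _ <-] := Bh y; exists x.
move=> x U; have [Bx|Bx] := pselect (B x).
  rewrite hB// => Ux.
  have nB : nbhs x B by apply: open_nbhs_nbhs; case: clB.
  have := continuous_comp (cphi x) (cg (phi x)) Ux.
  by apply: filterS2 nB => y By; rewrite /= hB.
rewrite hC// => Ux.
have nB : nbhs x (~` B).
  by apply: open_nbhs_nbhs; split => //; case: (clopenC set0 clB).
by apply: filterS2 nB Ux => y By; rewrite /= hC.
Qed.

(** Along a sequence of distinct isolated points [x n] tending to [p], move
[x n.+1] to [x n] and fix every other point, including [x 0]. At isolated points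
any map is continuous; any other point avoids the sequence, and the points near
it are hardly moved, since only finitely many jumps from [x n.+1] to [x n] are
large. *)
Lemma isolated_accumulation_noninj (R : realType) (X : metricType R) (p : X) :
  closure [set x : X | open [set x]] p -> ~ open [set p] ->
  exists2 h, continuous_surjections X h & ~ injective h.
Proof.
move=> clp np.
have pick_ (r : R) : exists x, 0 < r -> open [set x] /\ mdist p x < r.
  have [r0|r0] := pselect (0 < r); last by exists p.
  have [|x [Ix px]] := clp [set z | mdist p z < r].
    by rewrite -ballEmdist; exact: nbhsx_ballx.
  by exists x.
have [s sP] := choice pick_.
(* Decreasing distances to p make the sequence injective, and the bound 1/n
   makes it converge. *)
pose x := fix x n := s (if n is m.+1
  then Num.min (mdist p (x m)) n%:R^-1 else 1).
have open_ne q z : ~ open [set q] -> open [set z] -> q != z.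
  by move=> nq oz; apply/eqP => qz; apply: nq; rewrite qz.
have xP n : open [set x n] /\ 0 < mdist p (x n).
  elim: n => [|n [on pn]].
    by have [//|o0 _] := sP 1; split => //; rewrite mdist_gt0 open_ne.
  have [|oS _] := sP (Num.min (mdist p (x n)) n.+1%:R^-1).
    by rewrite lt_min pn invr_gt0 ltr0n.
  by split => //; rewrite mdist_gt0 open_ne.
have xS n : mdist p (x n.+1) < Num.min (mdist p (x n)) n.+1%:R^-1.
  have [|//] := sP (Num.min (mdist p (x n)) n.+1%:R^-1).
  by rewrite lt_min (xP n).2 invr_gt0 ltr0n.
have x_decr m n : (m < n)%N -> mdist p (x n) < mdist p (x m).
  elim: n => // n IH; rewrite ltnS leq_eqVlt => mn.
  have := xS n; rewrite lt_min => /andP[xnS _].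
  by case/predU1P: mn => [->//|/IH]; exact: lt_trans.
have x_inj : injective x.
  move=> m n xmn; have [mn|nm|//] := ltngtP m n.
    by have := x_decr _ _ mn; rewrite xmn ltxx.
  by have := x_decr _ _ nm; rewrite xmn ltxx.
pose h y :=
  if pselect (exists n, y = x n.+1) is left e then x (sval (cid e)) else y.
have hS n : h (x n.+1) = x n.
  rewrite /h; case: pselect => [e|]; last by case; exists n.
  case: (cid e) => m xnm; have [nm] := x_inj _ _ xnm.
  by rewrite [RHS](congr1 x nm).
have hid y : ~ (exists n, y = x n.+1) -> h y = y by rewrite /h; case: pselect.
exists h; last first.
  move=> hinj; have : x 1%N = x 0%N; last by move/x_inj.
  apply: hinj; rewrite hS hid// => -[n /x_inj] //.
split; last first.
  move=> y _; have [[n ->]|ny] := pselect (exists n, y = x n).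
    by exists (x n.+1).
  by exists y => //; apply: hid => -[n yn]; apply: ny; exists n.+1.
move=> q; have [oq|nq] := pselect (open [set q]).
  move=> U Uq; have : nbhs q [set q] by apply: open_nbhs_nbhs.
  by apply: filterS => y ->; exact: nbhs_singleton Uq.
have qx n : q != x n by apply: open_ne => //; have [] := xP n.
have hq : h q = q by apply: hid => -[n] /eqP; apply/negP.
apply/metricType_numDomainType.cvgrPdist_lt => e e0; rewrite hq.
have e4 : 0 < e / 4 by rewrite divr_gt0.
have [N Ne] : exists N : nat, N.+1%:R^-1 < e / 4 :> R.
  exists (Num.truncn (e / 4)^-1).
  by rewrite invf_plt ?posrE// truncnS_gt.
have away K : \forall y \near q, forall n, (n < K)%N -> y != x n.
  elim: K => [|K IH]; first exact: nearW.
  have nK : nbhs q [set y | y != x K].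
    have := nbhsx_ballx q (mdist q (x K)); rewrite mdist_gt0 ballEmdist => nb.
    apply: filterS (nb (qx K)) => y /=.
    by apply: contraTN => /eqP ->; rewrite ltxx.
  apply: filterS2 IH nK => y yK yneK n.
  by rewrite ltnS leq_eqVlt => /predU1P[->|/yK].
have nearq : nbhs q [set y | mdist q y < e / 4].
  by rewrite -ballEmdist; exact: nbhsx_ballx.
apply: filterS2 (away N.+2) nearq => y yN qy.
have [[n yn]|ny] := pselect (exists n, y = x n.+1); last first.
  by rewrite hid//; apply: lt_trans qy _; lra.
have Nn : (N < n)%N.
  by rewrite ltnNge; apply/negP => nN; have := yN n.+1 nN; rewrite yn eqxx.
have small k : (N < k)%N -> mdist p (x k) < e / 4.
  case: k => // k Nk; have := xS k; rewrite lt_min => /andP[_ xk].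
  apply: lt_trans xk _; apply: le_lt_trans Ne.
  by rewrite lef_pV2 ?posrE ?ltr0n// ler_nat.
rewrite yn hS; have := small _ Nn; have := small _ (leqW Nn).
have := metric_triangle q (x n.+1) (x n).
have := metric_triangle (x n.+1) p (x n).
rewrite (metric_sym _ p) -yn; move: qy => /=; lra.
Qed.

(** On an infinite space the cofinite sets form a proper filter, and a cluster
point of this filter cannot be isolated. *)
Lemma compact_infinite_nonisolated (X : topologicalType) :
  compact [set: X] -> infinite_set [set: X] -> exists x : X, ~ open [set x].
Proof.
move=> cptX infX; pose cofinite := [set A : set X | finite_set (~` A)].
have cofinite_filter : ProperFilter cofinite.
  split; first by rewrite /cofinite /= setC0.
  split => [|A B|A B AB]; rewrite /cofinite /=.
  - by rewrite setCT.
  - by rewrite setCI finite_setU.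
  - by apply: sub_finite_set => x nB /AB.
have [//|x [_ clx]] := cptX _ cofinite_filter; first exact: filterT.
exists x => ox; have [||y [ny yx]] := clx (~` [set x]) [set x].
- by rewrite /cofinite /= setCK; exact: finite_set1.
- exact: open_nbhs_nbhs.
- exact: ny.
Qed.

(** If the set [I] of isolated points is closed, its complement is a nonempty
open set, and any clopen set inside it has no isolated points. Cutting it by a
clopen set that misses some [v] makes it a proper subset of [X]. *)
Lemma zero_dimensional_noninj (R : realType) (X : metricType R) :
  compact [set: X] -> infinite_set [set: X] -> zero_dimensional X ->
  exists2 h, continuous_surjections X h & ~ injective h.
Proof.
move=> cptX infX zdX; pose I := [set x : X | open [set x]].
have [[p clp np]|nacc] := pselect (exists2 p, closure I p & ~ I p).
  exact: isolated_accumulation_noninj clp np.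
have clI : closed I.
  by move=> p clp; apply: contrapT => np; apply: nacc; exists p.
have [u nu] := compact_infinite_nonisolated cptX infX.
have [v uv] : exists v, u != v.
  apply: contrapT => /forallNP allu; apply: infX.
  apply: sub_finite_set (finite_set1 u) => v _ /=.
  by have /negP/negPn/eqP -> := allu v.
have [U [clU Uu Uv]] := zdX _ _ uv.
have [|C [Cu clC] CI] :=
  @zero_dimensional_cvg _ u (@metric_hausdorff _ X) zdX cptX (~` I).
  by apply: open_nbhs_nbhs; split => //; exact: closed_openC.
apply: (@perfect_clopen_noninj _ _ (C `&` U) v) => //.
- exact: clopenI.
- by exists u.
- by move=> x [/CI].
- by case.
Qed.

Theorem theorem19 (R : realType) (X : metricType R)
  (X_compact : compact [set: X])
  (X_infinite : infinite_set [set: X])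
  (X_rigid : rigid_space X)
  (f : X -> X) (f_cs : continuous_surjections X f) :
  ~ has_shadowing f.
Proof.
move=> sf.
have zdX := rigid_shadowing_zero_dimensional (X_rigid f f_cs) sf.
have [h h_cs] := zero_dimensional_noninj X_compact X_infinite zdX.
by apply; exact: uniformly_rigid_inj (X_rigid h h_cs).
Qed.
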